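(* Let $f(\mathbf x)=N(\mathbf x)/Q(\mathbf x)$ be an arithmetic expression whose outermost operation (the $k$-th of its $k$ operation occurrences) is a division, where $N$ and $Q$ are division-free and $Q(\mathbf x)\ne0$ for all $\mathbf x\in I_1\times\cdots\times I_m$; let $\tilde f$ be its floating-point model, assumed defined for all $\mathbf x$ in the ranges and all admissible $\mathbf e,\mathbf d$. For $i=1,\dots,k$ let $h_i(\mathbf x)=\frac{\partial\tilde f}{\partial e_i}(\mathbf x,\mathbf 0,\mathbf 0)\cdot(Q(\mathbf x))^2$ (written as polynomials in $\mathbf x$) and let $p$ be the output of the PN decomposition procedure applied to $h_1,\dots,h_k$. Let $c\in(0,1)$ and let $n\ge2$ be even. For $u\in\mathbb R$ let $K_u(\mathbf x)=p(\mathbf x)\epsilon-(Q(\mathbf x))^2u$, $\mu_u=\mathbb E[K_u(\mathbf x)]$ and $\mathrm{flag}_u=\mathbb E[(K_u(\mathbf x)-\mu_u)^n]/\mu_u^n$. Let $\ell=\mathbb E[p(\mathbf x)]\cdot\epsilon/\mathbb E[(Q(\mathbf x))^2]$ and $r=10^5\ell$, and suppose $U_c^{(1)}\in(\ell,r)$ satisfies $\mathrm{flag}_{U_c^{(1)}}\le1-c$ (as found by binary search). Let $U^{(2)}$ be any real number with $|R_2(\mathbf x,\mathbf e,\mathbf d)|\le U^{(2)}$ for all $\mathbf x\in I_1\times\cdots\times I_m$ and all admissible $\mathbf e,\mathbf d$, and let $U_c^*=U_c^{(1)}+U^{(2)}$. Then for every pair of random vectors $\mathbf e,\mathbf d$ (on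 the same probability space as $\mathbf x$) taking admissible values almost surely, $$\mathbb P[\mathrm{err}(f,\mathbf x)\ge U_c^*]\le1-c.$$
   Context: Arithmetic expression: built from real variables $\mathbf x=(x_1,\dots,x_m)$ and real constants using $+,-,\times,/$, operation occurrences numbered $1,\dots,k$; division-free means no division by a non-constant subexpression. Floating-point model: for constants $\epsilon,\delta>0$, $\tilde f(\mathbf x,\mathbf e,\mathbf d)$, $\mathbf e=(e_1,\dots,e_k)$, $\mathbf d=(d_1,\dots,d_k)$, is obtained by recursively replacing the $i$-th operation occurrence $a\circ b$ by $(a\circ b)(1+e_i)+d_i$, so $\tilde f(\mathbf x,\mathbf 0,\mathbf 0)=f(\mathbf x)$. Admissible: $|e_i|\le\epsilon$, $|d_i|\le\delta$. Inputs: $x_1,\dots,x_m$ independent real random variables, $x_j$ taking values in a bounded interval $I_j$; $\mathbb P,\mathbb E$ denote probability and expectation. $R_2(\mathbf x,\mathbf e,\mathbf d)=\tilde f(\mathbf x,\mathbf e,\mathbf d)-f(\mathbf x)-\sum_{i=1}^k\frac{\partial\tilde f}{\partial e_i}(\mathbf x,\mathbf 0,\mathbf 0)e_i$; $\mathrm{err}(f,\mathbf x)=|\tilde f(\mathbf x,\mathbf e,\mathbf d)-f(\mathbf x)|$. PN decomposition: for real $y$, $y^+=\max\{y,0\}$, $y^-=\max\{-y,0\}$; a term is $c\,y_1^{a_1}\cdots y_r^{a_r}$ with nonzero coefficient $c$, each $y_l^{a_l}$ a factor; polynomial form means a finite sum of terms. On input polynomials $g_1,\dots,g_k$: start with $p:=0$;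 for each $i$: expand $g_i$ into polynomial form in $x_1,\dots,x_m$; replace each factor $x_j^a$ with $a$ odd by $(x_j^+)^a-(x_j^-)^a$ if $I_j$ contains both positive and negative values, by $-(x_j^-)^a$ if $I_j\subseteq(-\infty,0]$, leaving it unchanged otherwise; expand again into polynomial form in symbols $x_j,x_j^+,x_j^-$ (possibly using $x_j^+x_j^-=0$); let $g_i^+$ be the sum of terms with positive coefficient and $g_i^-$ minus the sum of terms with negative coefficient; set $p:=p+g_i^++g_i^-$. $p(\mathbf x)$ denotes the value of $p$ with $x_j^\pm$ set to $\max\{\pm x_j,0\}$. *)

(* Defs.v *)
From HB Require Import structures.
From mathcomp Require Import all_boot all_order all_algebra.
From mathcomp Require Import all_classical all_reals all_analysis.
(* The notations of mpoly clash with those of mathcomp-analysis. *)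
From mathcomp Require mpoly.
Import -(notations) mpoly.

Set Implicit Arguments.
Unset Strict Implicit.
Unset Printing Implicit Defensive.

Import Order.TTheory GRing.Theory Num.Theory.
Import numFieldNormedType.Exports.

Local Open Scope classical_set_scope.
Local Open Scope ring_scope.

Inductive binop := Add | Sub | Mul | Div.

Inductive expr (R : Type) (m : nat) : Type :=
| Var of 'I_m
| Cst of R
| Op of binop & expr R m & expr R m.

Arguments Var {R m} _.
Arguments Cst {R m} _.
Arguments Op {R m} _ _ _.

Section Expressions.
Context {R : realType} {m : nat}.
Implicit Types (t a b : expr R m) (x : 'I_m -> R).

Definition op_eval (o : binop) (u v : R) : R :=
  match o with
  | Add => u + v
  | Sub => u - v
  | Mul => u * v
  | Div => u / v
  end.

Fixpoint expr_eval t x : R :=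
  match t with
  | Var j => x j
  | Cst c => c
  | Op o a b => op_eval o (expr_eval a x) (expr_eval b x)
  end.

Fixpoint is_constant t : bool :=
  match t with
  | Var _ => false
  | Cst _ => true
  | Op _ a b => is_constant a && is_constant b
  end.

Fixpoint division_free t : bool :=
  match t with
  | Op Div a b => [&& division_free a, division_free b & is_constant b]
  | Op _ a b => division_free a && division_free b
  | _ => true
  end.

(* The k operation occurrences of t are indexed by 'I_(nops t) in postfix
   order: those of the left operand, those of the right operand, and last the
   outermost operation. *)
Fixpoint nops t : nat :=
  match t with
  | Op _ a b => nops a + nops b + 1
  | _ => 0
  end.

Definition lft_errs a b (e : 'I_(nops a + nops b + 1) -> R) :
    'I_(nops a) -> R :=
  fun i => e (lshift 1 (lshift (nops b) i)).

Definition rgt_errs a b (e : 'I_(nops a + nops b + 1) -> R) :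
    'I_(nops b) -> R :=
  fun i => e (lshift 1 (rshift (nops a) i)).

Definition top_err a b (e : 'I_(nops a + nops b + 1) -> R) : R :=
  e (rshift (nops a + nops b) ord0).

Fixpoint fl_eval t x : ('I_(nops t) -> R) -> ('I_(nops t) -> R) -> R :=
  match t return ('I_(nops t) -> R) -> ('I_(nops t) -> R) -> R with
  | Var j => fun _ _ => x j
  | Cst c => fun _ _ => c
  | Op o a b => fun e d =>
      op_eval o (fl_eval x (lft_errs e) (lft_errs d))
                (fl_eval x (rgt_errs e) (rgt_errs d)) * (1 + top_err e)
      + top_err d
  end.

(* Division is total in MathComp (u / 0 = 0), so that the floating-point model
   being defined has to be stated: every divisor is nonzero. *)
Fixpoint fl_defined t x : ('I_(nops t) -> R) -> ('I_(nops t) -> R) -> Prop :=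
  match t return ('I_(nops t) -> R) -> ('I_(nops t) -> R) -> Prop with
  | Var _ | Cst _ => fun _ _ => True
  | Op o a b => fun e d =>
      [/\ fl_defined x (lft_errs e) (lft_errs d),
          fl_defined x (rgt_errs e) (rgt_errs d) &
          o = Div -> fl_eval x (rgt_errs e) (rgt_errs d) <> 0]
  end.

Lemma fl_eval0 t x : @fl_eval t x (fun=> 0) (fun=> 0) = expr_eval t x.
Proof.
elim: t => //= o a IHa b IHb.
by rewrite /top_err /= addr0 addr0 mulr1 -IHa -IHb.
Qed.

(* The partial derivative of fl_eval t with respect to e_i at (x, 0, 0). *)
Definition fl_partial t x (i : 'I_(nops t)) : R :=
  derive1
    (fun s : R => @fl_eval t x (fun j => if j == i then s else 0) (fun=> 0)) 0.

Definition remainder2 t x (e d : 'I_(nops t) -> R) : R :=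
  fl_eval x e d - expr_eval t x - \sum_(i < nops t) fl_partial x i * e i.

Definition fl_err t x (e d : 'I_(nops t) -> R) : R :=
  `| fl_eval x e d - expr_eval t x |.

Definition in_box (I : 'I_m -> interval R) x : Prop := forall j, x j \in I j.

End Expressions.

Arguments fl_eval {R m} t x e d.
Arguments fl_defined {R m} t x e d.
Arguments fl_partial {R m} t x i.
Arguments remainder2 {R m} t x e d.
Arguments fl_err {R m} t x e d.

Definition admissible {R : realType} (k : nat) (eps delta : R)
    (e d : 'I_k -> R) : Prop :=
  (forall i, `|e i| <= eps) /\ (forall i, `|d i| <= delta).

Section PNDecomposition.
Context {R : realType} {m : nat}.
Implicit Types (I : 'I_m -> interval R).

(* The 3m symbols x_j, x_j^+, x_j^- as variables of a polynomial ring. *)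
Definition pn_nsym : nat := m + m + m.
Definition sym (j : 'I_m) : 'I_pn_nsym := lshift m (lshift m j).
Definition symp (j : 'I_m) : 'I_pn_nsym := lshift m (rshift m j).
Definition symn (j : 'I_m) : 'I_pn_nsym := rshift (m + m) j.

Definition symX (s : 'I_pn_nsym) : mpoly pn_nsym R := mpolyX R (mnm1 s).

Definition pn_point (x : 'I_m -> R) (s : 'I_pn_nsym) : R :=
  match fintype.split s with
  | inl s' => match fintype.split s' with
              | inl j => x j
              | inr j => Num.max (x j) 0
              end
  | inr j => Num.max (- x j) 0
  end.

Definition pn_value (p : mpoly pn_nsym R) (x : 'I_m -> R) : R :=
  meval (pn_point x) p.

Definition pn_factor I (j : 'I_m) (a : nat) : mpoly pn_nsym R :=
  if odd a then
    if `[< (exists2 y, y \in I j & 0 < y) /\ (exists2 y, y \in I j & y < 0) >]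
    then symX (symp j) ^+ a - symX (symn j) ^+ a
    else if `[< forall y, y \in I j -> y <= 0 >]
    then - symX (symn j) ^+ a
    else symX (sym j) ^+ a
  else symX (sym j) ^+ a.

Definition pn_subst I (g : mpoly m R) : mpoly pn_nsym R :=
  \sum_(M <- msupp g) mcoeff M g *: \prod_(j < m) pn_factor I j (M j).

(* q' is obtained from q by replacing by 0 some (possibly none) of the terms
   in which x_j^+ x_j^- occurs for some j. *)
Definition pn_simplifies (q q' : mpoly pn_nsym R) : Prop :=
  forall M : multinom pn_nsym,
    mcoeff M q' = mcoeff M q \/
    mcoeff M q' = 0 /\ exists j, (0 < M (symp j))%N /\ (0 < M (symn j))%N.

Definition pos_terms (q : mpoly pn_nsym R) : mpoly pn_nsym R :=
  \sum_(M <- msupp q | 0 < mcoeff M q) mcoeff M q *: mpolyX R M.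

Definition neg_terms (q : mpoly pn_nsym R) : mpoly pn_nsym R :=
  - \sum_(M <- msupp q | mcoeff M q < 0) mcoeff M q *: mpolyX R M.

Definition PN_output I (k : nat) (g : 'I_k -> mpoly m R)
    (p : mpoly pn_nsym R) : Prop :=
  exists q : 'I_k -> mpoly pn_nsym R,
    (forall i, pn_simplifies (pn_subst I (g i)) (q i)) /\
    p = \sum_(i < k) (pos_terms (q i) + neg_terms (q i)).

End PNDecomposition.

Arguments pn_nsym : clear implicits.

Section Probability.
Context {d : measure_display} {T : measurableType d} {R : realType}.
Variable P : probability T R.

Definition mutually_independent (m : nat) (X : 'I_m -> {RV P >-> R}) : Prop :=
  forall (J : {set 'I_m}) (B : 'I_m -> set R),
    (forall j, measurable (B j)) ->
    P (\big[setI/setT]_(j in J) (X j @^-1` B j)) =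
    (\prod_(j in J) P (X j @^-1` B j))%E.

Definition expect (Y : T -> R) : R := fine ('E_P[Y])%E.

Definition flag (n : nat) (Y : T -> R) : R :=
  expect (fun w => (Y w - expect Y) ^+ n) / expect Y ^+ n.

End Probability.

(* Main.v *)
Require Import Defs.
From HB Require Import structures.
From mathcomp Require Import all_boot all_order all_algebra.
From mathcomp Require Import all_classical all_reals all_analysis.
From mathcomp Require Import measurable_realfun ess_sup_inf.
From mathcomp Require mpoly.
Import -(notations) mpoly.

Set Implicit Arguments.
Unset Strict Implicit.
Unset Printing Implicit Defensive.

Import Order.TTheory GRing.Theory Num.Theory.
Import numFieldNormedType.Exports.
Local Open Scope classical_set_scope.
Local Open Scope ring_scope.

(** Every monomial produced by the PN substitution is nonnegative on the box, so
    [p] dominates the sum of the [|h_i|]. In an error of size at least [U1 + U2]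
    the first-order part is at least [U1]; multiplied by [Q ^ 2], this gives
    [0 <= K U1]. But [K U1] has negative mean because [l < U1], and Markov's
    inequality for its [n]-th central moment bounds the probability of
    [0 <= K U1] by the flag. *)

Section NonnegativeMonomials.
Context {R : numDomainType} {n : nat}.
Implicit Types (v : 'I_n -> R).

Definition monomials_ge0 v : {pred mpoly n R} :=
  fun q => all (fun M => 0 <= meval v (mpolyX R M)) (msupp q).

Lemma monomials_ge0_subalg_closed v : subalg_closed (monomials_ge0 v).
Proof.
split=> [|a q1 q2 /allP q1_ge0 /allP q2_ge0|q1 q2 /allP q1_ge0 /allP q2_ge0].
- by rewrite unfold_in [msupp 1]msupp1 /= mpolyX0 meval1 ler01.
- apply/allP => M /msuppD_le; rewrite mem_cat.
  by move=> /orP[/msuppZ_le/q1_ge0|/q2_ge0].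
- apply/allP => M /msuppM_le /allpairsP[[M1 M2] /=].
  move=> [/q1_ge0 M1_ge0 /q2_ge0 M2_ge0 ->].
  by rewrite mpolyXD mevalM mulr_ge0.
Qed.

HB.instance Definition _ v := GRing.isSubalgClosed.Build R (mpoly n R)
  (monomials_ge0 v) (monomials_ge0_subalg_closed v).

Lemma monomials_ge0_Xn v i a :
  (mpolyX R (mnm1 i) ^+ a \in monomials_ge0 v) = (0 <= v i ^+ a).
Proof.
by rewrite mpolyXn unfold_in msuppX /= andbT -mpolyXn rmorphXn /= mevalXU.
Qed.

End NonnegativeMonomials.

Lemma odd_exprB_pos_neg (R : realDomainType) (x : R) (a : nat) : odd a ->
  Num.max x 0 ^+ a - Num.max (- x) 0 ^+ a = x ^+ a.
Proof.
move=> a_odd; have a_gt0 : (0 < a)%N by case: a a_odd.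
have [x_ge0|x_lt0] := leP 0 x.
  by rewrite max_r ?oppr_le0// expr0n gtn_eqF// subr0.
rewrite max_l ?oppr_ge0 ?ltW// expr0n gtn_eqF// exprNn -signr_odd a_odd.
by rewrite mulN1r sub0r opprK.
Qed.

Section PNDecomposition.
Context {R : realType} {m : nat}.
Implicit Types (I : 'I_m -> interval R) (x : 'I_m -> R).
Implicit Types (g : mpoly m R) (q : mpoly (pn_nsym m) R).

Lemma pn_point_sym x j : pn_point x (sym j) = x j.
Proof. by rewrite /pn_point /sym (unsplitK (inl _)) (unsplitK (inl _)). Qed.

Lemma pn_point_symp x j : pn_point x (symp j) = Num.max (x j) 0.
Proof. by rewrite /pn_point /symp (unsplitK (inl _)) (unsplitK (inr _)). Qed.

Lemma pn_point_symn x j : pn_point x (symn j) = Num.max (- x j) 0.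
Proof. by rewrite /pn_point /symn (unsplitK (inr _)). Qed.

Lemma meval_symXn x s a : meval (pn_point x) (symX s ^+ a) = pn_point x s ^+ a.
Proof. by rewrite rmorphXn /= mevalXU. Qed.

Lemma meval_pn_factor I x j a : in_box I x ->
  meval (pn_point x) (pn_factor I j a) = x j ^+ a.
Proof.
move=> xI; rewrite /pn_factor; case: ifPn => a_odd; last first.
  by rewrite meval_symXn pn_point_sym.
case: ifPn => [_|_].
  by rewrite mevalB !meval_symXn pn_point_symp pn_point_symn odd_exprB_pos_neg.
case: ifPn => [/asboolP I_le0|_]; last by rewrite meval_symXn pn_point_sym.
rewrite mevalN meval_symXn pn_point_symn -[RHS]odd_exprB_pos_neg//.
by rewrite (max_r (I_le0 _ (xI j))) expr0n gtn_eqF ?sub0r//; case: a a_odd.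
Qed.

Lemma pn_factor_monomials_ge0 I x j a : in_box I x ->
  pn_factor I j a \in monomials_ge0 (pn_point x).
Proof.
move=> xI; rewrite /pn_factor; case: ifPn => a_odd; last first.
  by rewrite monomials_ge0_Xn pn_point_sym exprn_even_ge0.
have symp_ge0 : symX (symp j) ^+ a \in monomials_ge0 (pn_point x).
  by rewrite monomials_ge0_Xn pn_point_symp exprn_ge0// le_max lexx orbT.
have symn_ge0 : symX (symn j) ^+ a \in monomials_ge0 (pn_point x).
  by rewrite monomials_ge0_Xn pn_point_symn exprn_ge0// le_max lexx orbT.
case: ifPn => [_|/asboolPn not_mixed]; first exact: rpredB.
case: ifPn => [_|/asboolPn not_le0]; first by rewrite rpredN.
rewrite monomials_ge0_Xn pn_point_sym exprn_ge0// leNgt; apply/negP => xj_lt0.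
apply: not_le0 => y yI; rewrite leNgt; apply/negP => y_gt0.
by apply: not_mixed; split; [exists y | exists (x j)].
Qed.

Lemma pn_value_subst I x g : in_box I x ->
  pn_value (pn_subst I g) x = meval x g.
Proof.
move=> xI; rewrite /pn_value /pn_subst raddf_sum mevalE.
apply: eq_bigr => M _ /=; rewrite mevalZ rmorph_prod; congr (_ * _).
by apply: eq_bigr => j _; exact: meval_pn_factor.
Qed.

Lemma pn_subst_monomials_ge0 I x g : in_box I x ->
  pn_subst I g \in monomials_ge0 (pn_point x).
Proof.
move=> xI; apply: rpred_sum => M _; apply/rpredZ/rpred_prod => j _.
exact: pn_factor_monomials_ge0.
Qed.

Lemma pn_simplifies_monomials_ge0 v q q' : pn_simplifies q q' ->
  q \in monomials_ge0 v -> q' \in monomials_ge0 v.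
Proof.
move=> qq' /allP q_ge0; apply/allP => M; rewrite mcoeff_msupp => q'M.
apply: q_ge0; rewrite mcoeff_msupp.
by case: (qq' M) => [<-//|[q'M0 _]]; rewrite q'M0 eqxx in q'M.
Qed.

Lemma meval_mixed_monomial x (M : multinom (pn_nsym m)) j :
  (0 < M (symp j))%N -> (0 < M (symn j))%N ->
  meval (pn_point x) (mpolyX R M) = 0.
Proof.
move=> Mp Mn; rewrite mevalX; apply/eqP/prodf_eq0.
have [x_ge0|x_lt0] := leP 0 (x j).
  by exists (symn j); rewrite // pn_point_symn max_r ?oppr_le0// expr0n gtn_eqF.
by exists (symp j); rewrite // pn_point_symp max_r ?ltW// expr0n gtn_eqF.
Qed.

Lemma pn_simplifies_value x q q' : pn_simplifies q q' ->
  pn_value q' x = pn_value q x.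
Proof.
move=> qq'; apply/eqP; rewrite -subr_eq0 /pn_value -mevalB; apply/eqP.
rewrite [q' - q]mpolyE raddf_sum big1_seq// => M _ /=.
rewrite mevalZ mcoeffB; case: (qq' M) => [->|[_ [j [Mp Mn]]]].
  by rewrite subrr mul0r.
by rewrite (meval_mixed_monomial _ Mp Mn) mulr0.
Qed.

Lemma pos_termsDneg_terms q : pos_terms q + neg_terms q =
  \sum_(M <- msupp q) `|mcoeff M q| *: mpolyX R M.
Proof.
rewrite /pos_terms /neg_terms big_mkcond [X in _ - X]big_mkcond /= -sumrB.
apply: eq_bigr => M _; case: ltgtP => [qM|qM|<-].
- by rewrite subr0 gtr0_norm.
- by rewrite sub0r ltr0_norm// scaleNr.
- by rewrite subr0 normr0 scale0r.
Qed.

Lemma norm_meval_le_pos_neg_terms v q : q \in monomials_ge0 v ->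
  `|meval v q| <= meval v (pos_terms q + neg_terms q).
Proof.
move=> /allP q_ge0; rewrite pos_termsDneg_terms {1}[q]mpolyE.
rewrite !(raddf_sum (meval v)) /=; apply: le_trans (ler_norm_sum _ _ _) _.
rewrite !big_seq; apply: ler_sum => M /q_ge0 M_ge0.
by rewrite !mevalZ normrM (ger0_norm M_ge0).
Qed.

Lemma PN_output_ge_sum_norm I k (g : 'I_k -> mpoly m R) p x :
  PN_output I g p -> in_box I x ->
  \sum_(i < k) `|meval x (g i)| <= pn_value p x.
Proof.
move=> [q [gq ->]] xI; rewrite /pn_value raddf_sum /=; apply: ler_sum => i _.
rewrite -(pn_value_subst _ xI) -(pn_simplifies_value _ (gq i)).
apply: norm_meval_le_pos_neg_terms; apply: pn_simplifies_monomials_ge0 (gq i) _.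
exact: pn_subst_monomials_ge0.
Qed.

End PNDecomposition.

Section FloatingPointError.
Context {R : realType} {m : nat}.
Implicit Types (f : expr R m) (y : 'I_m -> R).

Lemma fl_err_le f y (e d : 'I_(nops f) -> R) :
  fl_err f y e d <=
    \sum_i `|fl_partial f y i| * `|e i| + `|remainder2 f y e d|.
Proof.
rewrite /fl_err -[X in `|X|](subrK (\sum_i fl_partial f y i * e i)) addrC.
apply: le_trans (ler_normD _ _) _; rewrite lerD2r.
apply: le_trans (ler_norm_sum _ _ _) _.
by under eq_bigr do rewrite normrM.
Qed.

Lemma PN_output_ge_fl_err I f y (h : 'I_(nops f) -> mpoly m R) p (s eps : R)
    (e d : 'I_(nops f) -> R) :
  PN_output I h p -> in_box I y -> 0 <= s ->
  (forall i, meval y (h i) = fl_partial f y i * s) ->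
  0 <= eps -> (forall i, `|e i| <= eps) ->
  s * (fl_err f y e d - `|remainder2 f y e d|) <= pn_value p y * eps.
Proof.
move=> PN yI s_ge0 hE eps_ge0 e_le.
apply: le_trans (ler_wpM2r eps_ge0 (PN_output_ge_sum_norm PN yI)).
have := fl_err_le y e d; rewrite -lerBlDr => /(ler_wpM2l s_ge0)/le_trans; apply.
rewrite mulr_sumr mulr_suml; apply: ler_sum => i _.
by rewrite hE normrM (ger0_norm s_ge0) mulrA (mulrC s) ler_wpM2l// mulr_ge0.
Qed.

End FloatingPointError.

Lemma le_measure_ae {d} {T : measurableType d} {R : realType}
    (mu : {measure set T -> \bar R}) (A B : set T) :
  measurable A -> measurable B -> {ae mu, forall w, A w -> B w} ->
  (mu A <= mu B)%E.
Proof.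
move=> mA mB [Z [mZ Z0 ABZ]]; rewrite -(measureU0 mB mZ Z0).
apply: le_measure; rewrite ?inE//; first exact: measurableU.
move=> w Aw; have [Bw|nBw] := pselect (B w); [by left|right].
by apply: ABZ => /(_ Aw).
Qed.

Lemma measurable_set_le {d} {T : measurableType d} {R : realType}
    (Y Z : T -> R) :
  measurable_fun setT Y -> measurable_fun setT Z ->
  measurable [set w | Y w <= Z w].
Proof.
by move=> mY mZ; rewrite -[X in measurable X]setTI; exact: measurable_fun_le.
Qed.

Section BoundedMeasurableFunctions.
Context {d : measure_display} {T : measurableType d} {R : realType}.
Implicit Types (Y Z : T -> R).

Definition bounded_mfun : {pred T -> R} :=
  fun Y => `[< measurable_fun setT Y /\ exists B, forall w, `|Y w| <= B >].

Lemma bounded_mfunP Y :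
  reflect (measurable_fun setT Y /\ exists B, forall w, `|Y w| <= B)
          (Y \in bounded_mfun).
Proof. exact: asboolP. Qed.

Lemma bounded_mfun_cst (a : R) : cst a \in bounded_mfun.
Proof.
by apply/bounded_mfunP; split; [exact: measurable_cst | exists `|a|].
Qed.

Lemma bounded_mfun_subring_closed : subring_closed bounded_mfun.
Proof.
split=> [|Y Z|Y Z]; first exact: bounded_mfun_cst.
- move=> /bounded_mfunP[mY [B YB]] /bounded_mfunP[mZ [C ZC]].
  apply/bounded_mfunP; split; first exact: measurable_funB.
  by exists (B + C) => w; rewrite (le_trans (ler_normB _ _))// lerD.
- move=> /bounded_mfunP[mY [B YB]] /bounded_mfunP[mZ [C ZC]].
  apply/bounded_mfunP; split; first exact: measurable_funM.
  by exists (B * C) => w; rewrite normrM ler_pM.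
Qed.

HB.instance Definition _ := GRing.isSubringClosed.Build (T -> R)
  bounded_mfun bounded_mfun_subring_closed.

Lemma bounded_mfun_scaleB Y Z (a u : R) :
  Y \in bounded_mfun -> Z \in bounded_mfun ->
  (fun w => Y w * a - Z w * u) \in bounded_mfun.
Proof.
move=> bY bZ; exact: (rpredB (rpredM bY (bounded_mfun_cst a))
                             (rpredM bZ (bounded_mfun_cst u))).
Qed.

Lemma bounded_mfun_max Y Z : Y \in bounded_mfun -> Z \in bounded_mfun ->
  Y \max Z \in bounded_mfun.
Proof.
move=> /bounded_mfunP[mY [B YB]] /bounded_mfunP[mZ [C ZC]].
apply/bounded_mfunP; split; first exact: measurable_maxr.
exists (Num.max B C) => w; rewrite le_max /=.
by case: (leP (Y w) (Z w)) => _; rewrite ?YB ?ZC ?orbT.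
Qed.

Lemma bounded_mfun_meval n (v : T -> 'I_n -> R) (p : mpoly n R) :
  (forall i, v ^~ i \in bounded_mfun) ->
  (fun w => meval (v w) p) \in bounded_mfun.
Proof.
move=> bv.
have -> : (fun w => meval (v w) p) =
    \sum_(M <- msupp p) cst (mcoeff M p) * \prod_(i < n) (v ^~ i) ^+ M i.
  apply/funext => w; rewrite mevalE fct_sumE; apply: eq_bigr => M _.
  rewrite fct_prodE [RHS]/=; congr (_ * _).
  by apply: eq_bigr => i _; rewrite exprfctE.
apply: rpred_sum => M _; apply: rpredM; first exact: bounded_mfun_cst.
by apply: rpred_prod => i _; exact: rpredX.
Qed.

Lemma bounded_mfun_range (Y : {mfun T >-> R}) (A : set R) :
  bounded_set A -> (forall w, A (Y w)) -> (Y : T -> R) \in bounded_mfun.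
Proof.
move=> [B [_ AB]] YA; apply/bounded_mfunP; split; first exact: measurable_funP.
by exists (B + 1) => w; apply: AB (YA w); rewrite ltrDl.
Qed.

Lemma bounded_mfun_Lfun (mu : {finite_measure set T -> \bar R}) (p : \bar R) Y :
  (1 <= p)%E -> Y \in bounded_mfun -> Y \in Lfun mu p.
Proof.
move=> p_ge1 /bounded_mfunP[mY [B YB]].
suff Y_Linfty : Y \in Lfun mu +oo%E.
  by apply: Lfun_subset Y_Linfty; rewrite ?leey// fin_num_measure.
apply/andP; split; rewrite inE//= /finite_norm unlock.
case: ifP => _ //; apply: (@le_lt_trans _ _ B%:E); last exact: ltry.
apply: (@ess_sup_ler _ _ _ _ (Num.norm \o Y)) => w; rewrite lee_fin; exact: YB.
Qed.

End BoundedMeasurableFunctions.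

Section Expectation.
Context {d : measure_display} {T : measurableType d} {R : realType}.
Variable P : probability T R.
Implicit Types (Y Z : T -> R).

Lemma expect_gt0 Y : Y \in Lfun P 1 -> (forall w, 0 < Y w) -> 0 < expect P Y.
Proof.
move=> YL1 Y_gt0; have /Lfun1_integrable /integrableP[mY _] := YL1.
have EY_fin := expectation_fin_num YL1.
rewrite -lte_fin fineK// lt_neqAle eq_sym expectation_ge0 ?andbT; last first.
  by move=> w; exact: ltW.
apply/eqP => EY0.
have /(ae_eq_integral_abs P measurableT mY) [N [mN PN0 TN]] :
    (\int[P]_w `|(EFin \o Y) w| = 0)%E.
  rewrite -[RHS]EY0 unlock; apply: eq_integral => w _.
  by rewrite /= ger0_norm// ltW.
have NT : N = setT.
  apply/seteqP; split=> // w _; apply: TN => /= /(_ I)[Yw0].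
  by have := Y_gt0 w; rewrite Yw0 ltxx.
have /eqP := etrans (esym PN0) (congr1 P NT).
by rewrite probability_setT eq_sym onee_eq0.
Qed.

Lemma expect_scaleB_lt0 Y Z (a u : R) : Y \in Lfun P 1 -> Z \in Lfun P 1 ->
  0 < expect P Z -> expect P Y * a / expect P Z < u ->
  expect P (fun w => Y w * a - Z w * u) < 0.
Proof.
move=> YL1 ZL1 EZ_gt0; rewrite ltr_pdivrMr// -subr_lt0.
have -> : (fun w => Y w * a - Z w * u) = (a \o* Y) \- (u \o* Z) by [].
rewrite /expect expectationB ?Lfun_scale// !expectationZl//.
rewrite -(fineK (expectation_fin_num YL1)) -(fineK (expectation_fin_num ZL1)).
by rewrite /= [a * _]mulrC.
Qed.

Lemma flag_markov (n : nat) Y : (0 < n)%N -> ~~ odd n ->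
  Y \in Lfun P n%:R%:E -> expect P Y != 0 ->
  (P [set w | (`|expect P Y| <= `|Y w - expect P Y|)%R] <= (flag P n Y)%:E)%E.
Proof.
move=> n_gt0 n_even YLn EY_neq0; set mu := expect P Y.
have n_ge1 : (1%:E <= n%:R%:E :> \bar R)%E by rewrite lee_fin ler1n.
have CLn : Y \- cst mu \in Lfun P n%:R%:E.
  have -> : Y \- cst mu = Y \+ cst (- mu) by [].
  by apply: (Lfun_addr_closed P n_ge1).2 => //; exact: Lfun_cst.
pose C : {RV P >-> R} := mfun_Sub (sub_Lfun_mfun CLn).
pose M w := (Y w - mu) ^+ n.
have normM w : M w = `|Y w - mu| ^+ n.
  by rewrite -normrX ger0_norm// exprn_even_ge0.
have M_fin : ('E_P[M])%E \is a fin_num.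
  apply: expectation_fin_num; apply/Lfun1_integrable.
  have -> : EFin \o M = fun w => (`|(Y \- cst mu) w| `^ n%:R)%:E.
    by apply/funext => w /=; rewrite normM powR_mulrn.
  by apply: Lfun_integrable (CLn); rewrite ler1n.
have mu_n_gt0 : 0 < mu ^+ n by rewrite lt0r exprn_even_ge0// expf_neq0.
rewrite /flag -/mu -/M EFinM muleC lee_pdivlMl// fineK//.
have -> : M = (fun r => r ^+ n) \o (fun r => `|r|) \o C by exact/funext.
have -> : mu ^+ n = `|mu| ^+ n by rewrite -normrX gtr0_norm.
apply: (@markov _ _ _ P C (fun r => r ^+ n)) => //.
- by rewrite normr_gt0.
- by move=> r; exact: exprn_ge0.
- by move=> r s r_ge0 s_ge0 rs; rewrite lerXn2r.
Qed.

Lemma prob_ge0_le_flag (n : nat) Y : (0 < n)%N -> ~~ odd n ->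
  Y \in Lfun P n%:R%:E -> expect P Y < 0 ->
  (P [set w | (0 <= Y w)%R] <= (flag P n Y)%:E)%E.
Proof.
move=> n_gt0 n_even YLn EY_lt0.
have mY : measurable_fun setT Y by have := sub_Lfun_mfun YLn; rewrite inE.
have EY_neq0 : expect P Y != 0 by rewrite lt_eqF.
apply: le_trans (flag_markov n_gt0 n_even YLn EY_neq0).
apply: le_measure; rewrite ?inE.
- exact: measurable_set_le.
- apply: measurable_set_le => //.
  by apply: measurableT_comp => //; exact: measurable_funB.
- move=> w /= Yw_ge0.
  rewrite ltr0_norm// ger0_norm ?lerDr// subr_ge0.
  exact: le_trans (ltW EY_lt0) Yw_ge0.
Qed.

Lemma prob_scaleB_ge0_le_flag (n : nat) Y Z (a u : R) :
  (0 < n)%N -> ~~ odd n -> Y \in bounded_mfun -> Z \in bounded_mfun ->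
  (forall w, 0 < Z w) -> expect P Y * a / expect P Z < u ->
  (P [set w | (0 <= Y w * a - Z w * u)%R] <=
    (flag P n (fun w => Y w * a - Z w * u))%:E)%E.
Proof.
move=> n_gt0 n_even bY bZ Z_gt0 ratio_lt_u; apply: prob_ge0_le_flag => //.
  apply: bounded_mfun_Lfun; first by rewrite lee_fin ler1n.
  exact: bounded_mfun_scaleB.
apply: expect_scaleB_lt0 ratio_lt_u; rewrite ?bounded_mfun_Lfun//.
by apply: expect_gt0 => //; exact: bounded_mfun_Lfun.
Qed.

End Expectation.

Lemma measurable_invr {R : realType} : measurable_fun setT (@GRing.inv R).
Proof.
rewrite -(setvU [set 0 : R]); apply/measurable_funU => //.
  exact: measurableC.
split; last exact: measurable_fun_set1.
rewrite (_ : ~` _ = [set y | y != 0]); last first.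
  by apply/seteqP; split => y /= /eqP.
apply: open_continuous_measurable_fun; first exact: open_neq.
by move=> y; rewrite inE; exact: inv_continuous.
Qed.

Section MeasurableExpressions.
Context {disp : measure_display} {T : measurableType disp}.
Context {R : realType} {m : nat}.
Implicit Types (t : expr R m) (x : T -> 'I_m -> R).

Lemma measurable_op_eval o (Y Z : T -> R) :
  measurable_fun setT Y -> measurable_fun setT Z ->
  measurable_fun setT (fun w => op_eval o (Y w) (Z w)).
Proof.
move=> mY mZ; case: o => /=.
- exact: measurable_funD.
- exact: measurable_funB.
- exact: measurable_funM.
- by apply: measurable_funM => //; exact: measurableT_comp measurable_invr mZ.
Qed.

Lemma measurable_fl_eval t x (e d : T -> 'I_(nops t) -> R) :
  (forall j, measurable_fun setT (x ^~ j)) ->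
  (forall i, measurable_fun setT (e ^~ i)) ->
  (forall i, measurable_fun setT (d ^~ i)) ->
  measurable_fun setT (fun w => fl_eval t (x w) (e w) (d w)).
Proof.
move=> mx; elim: t e d => [j|a|o a IHa b IHb] e d me md /=.
- exact: mx.
- exact: measurable_cst.
- apply: measurable_funD; last exact: md.
  apply: measurable_funM; last by apply: measurable_funD; last exact: me.
  apply: measurable_op_eval.
  + by apply: (IHa (fun w => lft_errs (e w)) (fun w => lft_errs (d w))) => i;
      [exact: me | exact: md].
  + by apply: (IHb (fun w => rgt_errs (e w)) (fun w => rgt_errs (d w))) => i;
      [exact: me | exact: md].
Qed.

Lemma measurable_expr_eval t x : (forall j, measurable_fun setT (x ^~ j)) ->
  measurable_fun setT (fun w => expr_eval t (x w)).
Proof.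
move=> mx; under eq_fun do rewrite -fl_eval0.
by apply: measurable_fl_eval => // i; exact: measurable_cst.
Qed.

Lemma measurable_fl_err t x (e d : T -> 'I_(nops t) -> R) :
  (forall j, measurable_fun setT (x ^~ j)) ->
  (forall i, measurable_fun setT (e ^~ i)) ->
  (forall i, measurable_fun setT (d ^~ i)) ->
  measurable_fun setT (fun w => fl_err t (x w) (e w) (d w)).
Proof.
move=> mx me md; apply: measurableT_comp => //; apply: measurable_funB.
  exact: measurable_fl_eval.
exact: measurable_expr_eval.
Qed.

Lemma expr_eval_constant t (y z : 'I_m -> R) :
  is_constant t -> expr_eval t y = expr_eval t z.
Proof. by elim: t => //= o a IHa b IHb /andP[/IHa -> /IHb ->]. Qed.

Lemma bounded_mfun_expr_eval t x : division_free t ->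
  (forall j, x ^~ j \in bounded_mfun) ->
  (fun w => expr_eval t (x w)) \in bounded_mfun.
Proof.
move=> + bx; elim: t => [j|a|o a IHa b IHb] //=.
  by move=> _; exact: bounded_mfun_cst.
case: o => /=.
- by move=> /andP[/IHa ba /IHb bb]; exact: (rpredD ba bb).
- by move=> /andP[/IHa ba /IHb bb]; exact: (rpredB ba bb).
- by move=> /andP[/IHa ba /IHb bb]; exact: (rpredM ba bb).
- move=> /and3P[/IHa ba _ b_cst].
  under eq_fun do rewrite (expr_eval_constant _ (fun=> 0) b_cst).
  exact: (rpredM ba (bounded_mfun_cst _)).
Qed.

Lemma bounded_mfun_pn_value (p : mpoly (pn_nsym m) R) x :
  (forall j, x ^~ j \in bounded_mfun) ->
  (fun w => pn_value p (x w)) \in bounded_mfun.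
Proof.
move=> bx; apply: bounded_mfun_meval => s; rewrite /pn_point.
case: fintype.split => [s'|j]; first case: fintype.split => [j|j].
- exact: bx.
- exact: (bounded_mfun_max (bx j) (bounded_mfun_cst 0)).
- apply: (bounded_mfun_max _ (bounded_mfun_cst 0)).
  by have := bx j; rewrite -rpredN.
Qed.

End MeasurableExpressions.

Theorem theorem4p7 (R : realType) (disp : measure_display)
    (T : measurableType disp) (P : probability T R) (m : nat)
    (I : 'I_m -> interval R) (X : 'I_m -> {RV P >-> R})
    (eps delta : R) (N Q : expr R m)
    (h : 'I_(nops (Op Div N Q)) -> mpoly.mpoly m R)
    (p : mpoly.mpoly (pn_nsym m) R)
    (c : R) (n : nat) (U1 U2 : R) :
  let f := Op Div N Q in
  let x := fun (w : T) (j : 'I_m) => X j w in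
  let K := fun (u : R) (w : T) =>
    pn_value p (x w) * eps - (expr_eval Q (x w)) ^+ 2 * u in
  let l := expect P (fun w => pn_value p (x w)) * eps /
           expect P (fun w => (expr_eval Q (x w)) ^+ 2) in
  let r := 10 ^+ 5 * l in
  let Ustar := U1 + U2 in
  (forall j, bounded_set [set` I j]) ->
  (forall j w, X j w \in I j) ->
  mutually_independent X ->
  0 < eps -> 0 < delta ->
  division_free N -> division_free Q ->
  (forall y, in_box I y -> expr_eval Q y <> 0) ->
  (forall y e d, in_box I y -> admissible eps delta e d ->
     fl_defined f y e d) ->
  (forall i y, expr_eval Q y <> 0 ->
     mpoly.meval y (h i) = fl_partial f y i * (expr_eval Q y) ^+ 2) ->
  PN_output I h p ->
  0 < c < 1 ->
  (2 <= n)%N -> ~~ odd n ->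
  l < U1 < r ->
  flag P n (K U1) <= 1 - c ->
  (forall y e d, in_box I y -> admissible eps delta e d ->
     `| remainder2 f y e d | <= U2) ->
  forall e d : 'I_(nops f) -> {RV P >-> R},
    {ae P, forall w, admissible eps delta (e ^~ w) (d ^~ w)} ->
    (P [set w | (Ustar <= fl_err f (x w) (e ^~ w) (d ^~ w))%R] <= (1 - c)%:E)%E.
Proof.
move=> f x K l r Ustar bI XI _ eps_gt0 _ _ dfQ Q_neq0 _ hE PN _ n_ge2 n_even.
move=> /andP[l_lt_U1 _] flag_le R2_le e d adm.
have xI w : in_box I (x w) by move=> j; exact: XI.
have bx j : x ^~ j \in bounded_mfun by exact: bounded_mfun_range (bI j) (XI j).
have bp := bounded_mfun_pn_value p bx.
have bQ := bounded_mfun_expr_eval dfQ bx.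
have bQ2 : (fun w => expr_eval Q (x w) ^+ 2) \in bounded_mfun.
  exact: (rpredM bQ bQ).
have Q2_gt0 w : 0 < expr_eval Q (x w) ^+ 2.
  by rewrite exprn_even_gt0//=; apply/eqP/Q_neq0.
have K_ge0_prob :=
  prob_scaleB_ge0_le_flag (ltnW n_ge2) n_even bp bQ2 Q2_gt0 l_lt_U1.
apply: (le_trans (le_trans _ K_ge0_prob)); last by rewrite lee_fin.
apply: le_measure_ae.
- apply: measurable_set_le => //.
  by apply: measurable_fl_err => ?; exact: measurable_funP.
- apply: measurable_set_le => //.
  by case/bounded_mfunP: (bounded_mfun_scaleB eps U1 bp bQ2).
- apply: filterS adm => w w_adm /= err_ge; rewrite subr_ge0.
  have hE_w i := hE i (x w) (Q_neq0 _ (xI w)).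
  apply: le_trans (PN_output_ge_fl_err (d ^~ w) PN (xI w) (sqr_ge0 _) hE_w
    (ltW eps_gt0) w_adm.1).
  by rewrite ler_wpM2l ?sqr_ge0// lerBrDr (le_trans _ err_ge)// lerD2l R2_le.
Qed.
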